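(* For every $r\in\mathbb N$, all coefficients of the $q$-series expansion of \[ (-q;q^2)_\infty\left(\sum_{k=0}^{\infty}\frac{q^{2kr+1}}{1-q^{2(2kr+1)}}-\sum_{k=1}^{\infty}\frac{q^{4kr}}{1-q^{4kr}}\right) \] are non-negative.
   Context: $(a;q)_\infty:=\prod_{j=0}^\infty(1-aq^j)$; series are formal power series in $q$. *)

(* Defs.v *)
From HB Require Import structures.
From mathcomp Require Import all_boot all_order all_algebra.
From mathcomp Require Import boolp classical_sets.
Set Implicit Arguments. Unset Strict Implicit. Unset Printing Implicit Defensive.
Import Order.TTheory GRing.Theory Num.Theory.
Local Open Scope ring_scope.

(** The ring Z[[q]].  It is a record, and not an alias of [nat -> int], so that
    the Cauchy product cannot be confused with a pointwise one. *)
Record fps := Fps { fps_coef : nat -> int }.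

Lemma fpsP (f g : fps) : fps_coef f =1 fps_coef g -> f = g.
Proof. by case: f g => [f] [g] /= /funext ->. Qed.

HB.instance Definition _ := gen_eqMixin fps.
HB.instance Definition _ := gen_choiceMixin fps.

Definition fps_zero : fps := Fps (fun _ => 0).
Definition fps_opp (f : fps) : fps := Fps (fun n => - fps_coef f n).
Definition fps_add (f g : fps) : fps := Fps (fun n => fps_coef f n + fps_coef g n).

Fact fps_addA : associative fps_add.
Proof. by move=> f g h; apply: fpsP => n /=; rewrite addrA. Qed.
Fact fps_addC : commutative fps_add.
Proof. by move=> f g; apply: fpsP => n /=; rewrite addrC. Qed.
Fact fps_add0 : left_id fps_zero fps_add.
Proof. by move=> f; apply: fpsP => n /=; rewrite add0r. Qed.
Fact fps_addN : left_inverse fps_zero fps_opp fps_add.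
Proof. by move=> f; apply: fpsP => n /=; rewrite addNr. Qed.

HB.instance Definition _ :=
  GRing.isZmodule.Build fps fps_addA fps_addC fps_add0 fps_addN.

Definition fps_one : fps := Fps (fun n => (n == 0%N)%:R).
Definition fps_mul (f g : fps) : fps :=
  Fps (fun n => \sum_(i < n.+1) fps_coef f i * fps_coef g (n - i)%N).

Definition fps_trunc (m : nat) (f : fps) : {poly int} := \poly_(i < m) fps_coef f i.

Fact fps_mul_trunc m f g n : (n < m)%N ->
  fps_coef (fps_mul f g) n = (fps_trunc m f * fps_trunc m g)`_n.
Proof.
move=> ltnm; rewrite coefM; apply: eq_bigr => i _; rewrite !coef_poly.
have lein : (i <= n)%N by rewrite -ltnS.
by rewrite (leq_ltn_trans lein ltnm) (leq_ltn_trans (leq_subr _ _) ltnm).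
Qed.

Fact fps_mulC : commutative fps_mul.
Proof. by move=> f g; apply: fpsP => n; rewrite !(@fps_mul_trunc n.+1) // mulrC. Qed.

Fact fps_mulA : associative fps_mul.
Proof.
move=> f g h; apply: fpsP => n.
transitivity (fps_trunc n.+1 f * fps_trunc n.+1 g * fps_trunc n.+1 h)`_n.
  rewrite -mulrA coefM; apply: eq_bigr => i _.
  rewrite coef_poly ltn_ord; congr (_ * _).
  by rewrite (@fps_mul_trunc n.+1) // ltnS leq_subr.
rewrite coefM; apply: eq_bigr => i _.
rewrite (@fps_mul_trunc n.+1) // coef_poly ifT //.
by rewrite ltnS leq_subr.
Qed.

Fact fps_mul1 : left_id fps_one fps_mul.
Proof.
move=> f; apply: fpsP => n /=; rewrite big_ord_recl /= mul1r subn0.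
by rewrite big1 ?addr0 // => i _; rewrite mul0r.
Qed.

Fact fps_mulDl : left_distributive fps_mul fps_add.
Proof.
move=> f g h; apply: fpsP => n /=; rewrite -big_split /=.
by apply: eq_bigr => i _; rewrite mulrDl.
Qed.

Fact fps_one_neq0 : fps_one != fps_zero.
Proof. by apply/eqP => /(congr1 (fps_coef^~ 0%N)). Qed.

HB.instance Definition _ := GRing.Zmodule_isComNzRing.Build fps
  fps_mulA fps_mulC fps_mul1 fps_mulDl fps_one_neq0.

Definition fps_unit : {pred fps} := fun f => `[< exists g : fps, g * f = 1 >].
Definition fps_inv (f : fps) : fps := xget f [set g : fps | g * f = 1]%classic.

Fact fps_mulVx : {in fps_unit, left_inverse 1 fps_inv *%R}.
Proof. by move=> f /asboolP; apply: xgetPex. Qed.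
Fact fps_unitPl (f g : fps) : g * f = 1 -> fps_unit f.
Proof. by move=> gf; apply/asboolP; exists g. Qed.
Fact fps_invr_out : {in [predC fps_unit], fps_inv =1 id}.
Proof.
move=> f; rewrite inE => /asboolP nf.
by apply: xgetPN => g gf; apply: nf; exists g.
Qed.

HB.instance Definition _ := GRing.ComNzRing_hasMulInverse.Build fps
  fps_mulVx fps_unitPl fps_invr_out.

(** The variable q. *)
Definition fps_q : fps := Fps (fun n => (n == 1%N)%:R).

Definition fps_cvg (u : nat -> fps) (f : fps) : Prop :=
  forall n, exists N, forall k, (N <= k)%N -> fps_coef (u k) n = fps_coef f n.

(** Junk value 0 when [u] does not converge. *)
Definition fps_lim (u : nat -> fps) : fps := xget 0 [set f | fps_cvg u f]%classic.

(** [fps_series m u] is the sum of the [u k] for [m <= k]. *)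
Definition fps_series (m : nat) (u : nat -> fps) : fps :=
  fps_lim (fun n => \sum_(m <= k < n) u k).

(** (a; b)_oo. *)
Definition qpochhammer (a b : fps) : fps :=
  fps_lim (fun n => \prod_(0 <= j < n) (1 - a * b ^+ j)).

(** The facts below show that no junk value (of [^-1] or of [fps_lim]) occurs in
    the series under consideration. *)

Lemma fps_cvg_unique u f g : fps_cvg u f -> fps_cvg u g -> f = g.
Proof.
move=> uf ug; apply: fpsP => n; have [N HN] := uf n; have [M HM] := ug n.
by rewrite -(HN (maxn N M)) ?leq_maxl // -(HM (maxn N M)) ?leq_maxr.
Qed.

Lemma fps_limE u f : fps_cvg u f -> fps_lim u = f.
Proof. by move=> uf; apply: xget_unique => // g ug; apply: fps_cvg_unique uf. Qed.

Lemma fps_coefM (f g : fps) n :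
  fps_coef (f * g) n = \sum_(i < n.+1) fps_coef f i * fps_coef g (n - i)%N.
Proof. by []. Qed.

Lemma fps_coefXn m n : fps_coef (fps_q ^+ m) n = (n == m)%:R.
Proof.
elim: m n => [|m IHm] n; first by rewrite expr0.
rewrite exprS fps_coefM; case: n => [|n].
  by rewrite big_ord_recl big_ord0 /= mul0r.
rewrite !big_ord_recl /= mul0r mul1r add0r big1 ?addr0; last by move=> i _; rewrite mul0r.
by rewrite IHm subSS subn0 eqSS.
Qed.

Definition fps_vanish (m : nat) (f : fps) : Prop :=
  forall n, (n < m)%N -> fps_coef f n = 0.

Lemma fps_vanishMl m f g : fps_vanish m g -> fps_vanish m (f * g).
Proof.
move=> vg n ltnm; rewrite fps_coefM big1 // => i _.
by rewrite vg ?mulr0 // (leq_ltn_trans (leq_subr _ _)).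
Qed.

Lemma fps_vanishMr m f g : fps_vanish m f -> fps_vanish m (f * g).
Proof. by rewrite mulrC; apply: fps_vanishMl. Qed.

Lemma fps_vanishXn m k : (m <= k)%N -> fps_vanish m (fps_q ^+ k).
Proof. by move=> lemk n ltnm; rewrite fps_coefXn (ltn_eqF (leq_trans ltnm lemk)). Qed.

Lemma fps_lim_cvg u : (forall k, fps_vanish k (u k.+1 - u k)) -> fps_cvg u (fps_lim u).
Proof.
move=> vu; have uE n k : (n < k)%N -> fps_coef (u k) n = fps_coef (u n.+1) n.
  elim: k => // k IHk; rewrite ltnS leq_eqVlt => /predU1P[-> //|ltnk].
  by rewrite -(IHk ltnk); apply/eqP; rewrite -subr_eq0; apply/eqP/(vu k n).
have uf : fps_cvg u (Fps (fun n => fps_coef (u n.+1) n)).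
  by move=> n; exists n.+1 => k; apply: uE.
by rewrite (fps_limE uf).
Qed.

Lemma fps_series_cvg m u : (forall k, (m <= k)%N -> fps_vanish k (u k)) ->
  fps_cvg (fun n => \sum_(m <= k < n) u k) (fps_series m u).
Proof.
move=> vu; apply: fps_lim_cvg => k; have [lemk|ltkm] := leqP m k.
  by rewrite big_nat_recr //= addrAC subrr add0r; apply: vu.
by rewrite !big_geq ?subrr // ltnW.
Qed.

Lemma qpochhammer_cvg a b : (forall j, fps_vanish j (a * b ^+ j)) ->
  fps_cvg (fun n => \prod_(0 <= j < n) (1 - a * b ^+ j)) (qpochhammer a b).
Proof.
move=> vab; apply: fps_lim_cvg => k.
rewrite big_nat_recr //= mulrBr mulr1 addrAC subrr add0r -mulrN.
by apply: fps_vanishMl => n ltnk; rewrite -mulrN1 (fps_vanishMr _ (vab k)).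
Qed.

Lemma fps_unit_subXn m : (0 < m)%N -> 1 - fps_q ^+ m \is a GRing.unit.
Proof.
move=> m_gt0; pose u k : fps := fps_q ^+ (m * k).
have /fps_series_cvg cu k : (0 <= k)%N -> fps_vanish k (u k).
  by move=> _; apply: fps_vanishXn; rewrite leq_pmull.
apply/unitrPr; exists (fps_series 0 u); apply: fpsP => n.
have /choice[N HN] := cu.
pose K := (n.+1 + \sum_(i < n.+1) N i)%N.
have KE i : (i <= n)%N -> fps_coef (fps_series 0 u) i = fps_coef (\sum_(0 <= k < K) u k) i.
  move=> lein; rewrite HN // /K (bigD1 (Ordinal (lein : (i < n.+1)%N))) //=.
  by rewrite addnCA leq_addr.
transitivity (fps_coef ((1 - fps_q ^+ m) * \sum_(0 <= k < K) u k) n).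
  by rewrite !fps_coefM; apply: eq_bigr => i _; rewrite KE // leq_subr.
have -> : \sum_(0 <= k < K) u k = \sum_(k < K) (fps_q ^+ m) ^+ k.
  by rewrite big_mkord; apply: eq_bigr => k _; rewrite /u exprM.
rewrite -opprB mulNr -subrX1 opprB -exprM.
have := @fps_vanishXn n.+1 (m * K); rewrite /fps_vanish => /(_ _ n (leqnn _)) v.
change (fps_coef 1 n - fps_coef (fps_q ^+ (m * K)) n = fps_coef 1 n).
by rewrite v ?subr0 // (leq_trans _ (leq_pmull _ _)) // leq_addr.
Qed.

Lemma qpochhammer_mq_cvg :
  fps_cvg (fun n => \prod_(0 <= j < n) (1 - - fps_q * (fps_q ^+ 2) ^+ j))
    (qpochhammer (- fps_q) (fps_q ^+ 2)).
Proof.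
apply: qpochhammer_cvg => j; apply: fps_vanishMl; rewrite -exprM.
by apply: fps_vanishXn; rewrite leq_pmull.
Qed.

Lemma fps_series_odd_cvg r : (0 < r)%N ->
  let u k := fps_q ^+ (2 * k * r + 1) / (1 - fps_q ^+ (2 * (2 * k * r + 1))) in
  fps_cvg (fun n => \sum_(0 <= k < n) u k) (fps_series 0 u).
Proof.
move=> r_gt0 u; apply: fps_series_cvg => k _; apply: fps_vanishMr.
apply: fps_vanishXn; rewrite (leq_trans _ (leq_addr _ _)) //.
by rewrite (leq_trans _ (leq_pmulr _ _)) // leq_pmull.
Qed.

Lemma fps_series_even_cvg r : (0 < r)%N ->
  let u k := fps_q ^+ (4 * k * r) / (1 - fps_q ^+ (4 * k * r)) in
  fps_cvg (fun n => \sum_(1 <= k < n) u k) (fps_series 1 u).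
Proof.
move=> r_gt0 u; apply: fps_series_cvg => k _; apply: fps_vanishMr.
by apply: fps_vanishXn; rewrite (leq_trans _ (leq_pmulr _ _)) // leq_pmull.
Qed.

(* Main.v *)
Require Import Defs.
From mathcomp Require Import all_boot all_order all_algebra.
From mathcomp Require Import zify ring.
Set Implicit Arguments. Unset Strict Implicit. Unset Printing Implicit Defensive.
Import Order.TTheory GRing.Theory Num.Theory.
Local Open Scope ring_scope.

(** Write [f] for the coefficients of F = (-q;q^2)_oo.  Expanding the geometric
    series, the bracket is the sum of q^((2rK+1)(2J+1)) over K, J >= 0 minus the
    sum of q^(4rkl) over k, l >= 1.  Send (k, l) to (K, J) = (k, l-1) if
    l <= rk, and to (k-1, l) otherwise.  This is injective, misses (0, 0), and
    the exponent of the image is smaller by an odd number d.  Adding 2 to the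
    largest part shows that (1-q)F = 1 - q^2 + q^3 + (non-negative), whence
    f(m) <= f(m+d) for all odd d, except that f(1) = f(2) + 1.  The exception
    occurs only for l = rk and in degree n = (2rk)^2 + 1, hence for at most one
    pair (k, l), and the unmatched term qF contributes f(n-1) >= 1 there. *)

(** * Coefficients of products and finite truncations of Lambert series *)

Section Coefficients.
Implicit Types (f g h : fps) (u : nat -> fps).

Lemma fps_coefD f g n : fps_coef (f + g) n = fps_coef f n + fps_coef g n.
Proof. by []. Qed.

Lemma fps_coefB f g n : fps_coef (f - g) n = fps_coef f n - fps_coef g n.
Proof. by []. Qed.

Lemma fps_coef_sum (I : Type) (s : seq I) (P : pred I) (F : I -> fps) n :
  fps_coef (\sum_(i <- s | P i) F i) n = \sum_(i <- s | P i) fps_coef (F i) n.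
Proof. exact: (big_morph (fps_coef^~ n) (fun f g => fps_coefD f g n)). Qed.

Lemma fps_coefMXn f a n :
  fps_coef (f * fps_q ^+ a) n = if (a <= n)%N then fps_coef f (n - a) else 0.
Proof.
rewrite mulrC fps_coefM; case: leqP => [lean|ltna].
  rewrite (bigD1 (Ordinal (lean : (a < n.+1)%N))) //= fps_coefXn eqxx mul1r.
  rewrite big1 ?addr0 // => i neq; rewrite fps_coefXn.
  by rewrite (negbTE (_ : (i : nat) != a)) ?mul0r.
rewrite big1 // => i _; rewrite fps_coefXn.
by rewrite (ltn_eqF (leq_trans (ltn_ord i) ltna)) mul0r.
Qed.

Definition fps_nneg f : Prop := forall n, 0 <= fps_coef f n.

Lemma fps_nneg0 : fps_nneg 0. Proof. by []. Qed.

Lemma fps_nnegXn m : fps_nneg (fps_q ^+ m).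
Proof. by move=> n; rewrite fps_coefXn ler0n. Qed.

Lemma fps_nnegD f g : fps_nneg f -> fps_nneg g -> fps_nneg (f + g).
Proof. by move=> f0 g0 n; rewrite fps_coefD addr_ge0. Qed.

Lemma fps_nnegM f g : fps_nneg f -> fps_nneg g -> fps_nneg (f * g).
Proof. by move=> f0 g0 n; rewrite fps_coefM sumr_ge0 // => i _; rewrite mulr_ge0. Qed.

Lemma fps_vanishD m f g : fps_vanish m f -> fps_vanish m g -> fps_vanish m (f + g).
Proof. by move=> vf vg n ltnm; rewrite fps_coefD vf ?vg. Qed.

Lemma fps_vanish_sum m (I : Type) (s : seq I) (P : pred I) (F : I -> fps) :
  (forall i, P i -> fps_vanish m (F i)) -> fps_vanish m (\sum_(i <- s | P i) F i).
Proof. by move=> vF n ltnm; rewrite fps_coef_sum big1 // => i Pi; apply: vF. Qed.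

(** Terms of index at least [N] have order at least [N], so all partial sums from [N] on agree below
    degree [N]. *)
Lemma fps_series_trunc m N A u : (N <= A)%N ->
    (forall k, (m <= k)%N -> fps_vanish k (u k)) ->
  fps_vanish N (fps_series m u - \sum_(m <= k < A) u k).
Proof.
move=> leNA vu n ltnN; have [M HM] := fps_series_cvg vu n.
have tail B : (N <= B)%N ->
    fps_coef (\sum_(m <= k < B) u k) n = \sum_(m <= k < N) fps_coef (u k) n.
  move=> leNB; rewrite fps_coef_sum.
  have [leNm|ltmN] := leqP N m.
    rewrite [RHS]big_geq // big_nat_cond big1 // => k /andP[/andP[lemk _] _].
    by apply: vu => //; apply: leq_trans ltnN (leq_trans leNm lemk).
  rewrite (big_cat_nat (n := N)) //=; last exact: ltnW.
  rewrite [X in _ + X]big_nat_cond [X in _ + X]big1 ?addr0 //.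
  move=> k /andP[/andP[leNk _] _].
  by apply: vu; [apply: leq_trans (ltnW ltmN) leNk|apply: leq_trans ltnN leNk].
by rewrite fps_coefB -(HM (maxn M N)) ?leq_maxl // !tail ?subrr ?leq_maxr.
Qed.

(** The remainder is q^(a + pB) / (1 - q^p), and pB >= N. *)
Lemma fps_geometric_trunc a p N B : (N <= B)%N -> (0 < p)%N ->
  fps_vanish N (fps_q ^+ a / (1 - fps_q ^+ p)
                - \sum_(j < B) fps_q ^+ (a + p * j)).
Proof.
move=> leNB p_gt0; have up := fps_unit_subXn p_gt0.
have -> : \sum_(j < B) fps_q ^+ (a + p * j)
    = fps_q ^+ a * (1 - fps_q ^+ (p * B)) / (1 - fps_q ^+ p).
  apply: (canRL (mulrK up)); rewrite exprM -[1 - (fps_q ^+ p) ^+ B]opprB subrX1.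
  rewrite -mulNr opprB mulrCA mulrC; congr (_ * _); rewrite mulr_sumr.
  by apply: eq_bigr => j _; rewrite exprD exprM.
rewrite -mulrBl mulrBr mulr1 opprB addrC subrK.
apply/fps_vanishMr/fps_vanishMl/fps_vanishXn.
by rewrite (leq_trans leNB) // leq_pmull.
Qed.

Lemma lambert_trunc (e p : nat -> nat) m N A B : (N <= A)%N -> (N <= B)%N ->
    (forall k, (m <= k)%N -> (k <= e k)%N && (0 < p k)%N) ->
  fps_vanish N (fps_series m (fun k => fps_q ^+ e k / (1 - fps_q ^+ p k))
                - \sum_(m <= k < A) \sum_(j < B) fps_q ^+ (e k + p k * j)).
Proof.
move=> leNA leNB Hep; set u := fun k => _.
rewrite -(subrK (\sum_(m <= k < A) u k) (fps_series m u)) -addrA.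
apply: fps_vanishD.
  apply: fps_series_trunc => // k /Hep /andP[ek _].
  exact/fps_vanishMr/fps_vanishXn.
rewrite -sumrB big_nat_cond; apply: fps_vanish_sum => k /andP[/andP[/Hep]].
by case/andP=> _ pk _ _; apply: fps_geometric_trunc.
Qed.

End Coefficients.

(** * Near-monotonicity of the numbers of partitions into distinct odd parts *)

Section DistinctOddParts.

Local Notation F := (qpochhammer (- fps_q) (fps_q ^+ 2)).

(** The factor 1 + q of [F] is left out: it combines with 1 - q into 1 - q^2. *)
Let P n : fps := \prod_(0 <= j < n) (1 + fps_q ^+ (2 * j + 3)).

Let PS n : P n.+1 = P n * (1 + fps_q ^+ (2 * n + 3)).
Proof. by rewrite /P big_nat_recr. Qed.

Let P_nneg n : fps_nneg (P n).
Proof.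
elim: n => [|n IHn]; first by rewrite /P big_geq // -(expr0 fps_q); apply: fps_nnegXn.
rewrite PS; apply: fps_nnegM => //; apply: fps_nnegD; last exact: fps_nnegXn.
by rewrite -(expr0 fps_q); apply: fps_nnegXn.
Qed.

Let prodF n :
  \prod_(0 <= j < n.+1) (1 - - fps_q * (fps_q ^+ 2) ^+ j) = (1 + fps_q) * P n.
Proof.
rewrite big_nat_recl //= expr0 mulr1 opprK; congr (_ * _).
by apply: eq_bigr => j _; rewrite mulNr opprK -exprM -exprS; congr (1 + _ ^+ _); lia.
Qed.

(** Raising the largest part by 2 cancels most negative terms. The [h] built here counts partitions
    whose two largest parts differ by 2, which no raise produces. The last term collects the raises
    of 2n+3 to 2n+5, a part too large for [P n.+1]; its order tends to infinity. *)
Let one_subX2_prod n : exists2 h : fps, fps_nneg h &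
  (1 - fps_q ^+ 2) * P n.+1 =
    1 - fps_q ^+ 2 + fps_q ^+ 3 + h - fps_q ^+ (2 * n + 5) * P n.
Proof.
elim: n => [|n [h h0 IHn]].
  exists 0; first exact: fps_nneg0.
  by rewrite PS /P big_geq //= mul1r mulr1 muln0 !add0n; ring.
exists (h + fps_q ^+ (2 * n + 5) * (fps_q ^+ (2 * n + 3) * P n)).
  by apply: fps_nnegD => //; do 2![apply: fps_nnegM; first exact: fps_nnegXn].
rewrite [in LHS]PS mulrDr mulr1 mulrDr mulrA IHn.
rewrite (_ : 2 * n.+1 + 3 = 2 * n + 5)%N; last lia.
rewrite (_ : 2 * n.+1 + 5 = 2 * n + 5 + 2)%N; last lia.
rewrite [fps_q ^+ (2 * n + 5 + 2)]exprD PS.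
by ring.
Qed.

Let f n := fps_coef F n.

Let coef_mul_one_subX (g : fps) n :
  fps_coef (g * (1 - fps_q)) n =
    fps_coef g n - (if (0 < n)%N then fps_coef g n.-1 else 0).
Proof. by rewrite mulrBr mulr1 fps_coefB -(expr1 fps_q) fps_coefMXn subn1. Qed.

Let f_low (n : nat) :
  (n == 0%N)%:R - (n == 2%N)%:R + (n == 3%N)%:R <= f n - (if (0 < n)%N then f n.-1 else 0).
Proof.
have [N1 H1] := qpochhammer_mq_cvg n.
have [N2 H2] := qpochhammer_mq_cvg n.-1.
(* Large enough for the product to have its limit coefficients in degrees [n] and [n.-1], and for
   the boundary term, of order at least 2N+5, to vanish in degree [n]. *)
pose N := (N1 + N2 + n)%N; have [h h0 hE] := one_subX2_prod N.
rewrite /f -(H1 N.+2) -?(H2 N.+2); try lia.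
rewrite -coef_mul_one_subX prodF.
have -> : (1 + fps_q) * P N.+1 * (1 - fps_q) = (1 - fps_q ^+ 2) * P N.+1 by ring.
rewrite hE [leRHS]fps_coefB (fps_vanishMr _ (@fps_vanishXn n.+1 _ _)) //; last lia.
rewrite subr0 [leRHS]fps_coefD -!fps_coefXn -fps_coefB -fps_coefD expr0.
by rewrite lerDl.
Qed.

Let f_step n : f n + (n.+1 == 3%N)%:R <= f n.+1 + (n.+1 == 2%N)%:R.
Proof. by have := f_low n.+1; rewrite /=; lia. Qed.

Let f0_ge1 : 1 <= f 0%N.
Proof. by have := f_low 0; rewrite /=; lia. Qed.

(** By [f_step] a drop can occur only from degree 1 to degree 2; from degree 2 on it is never
    crossed. *)
Let f_mono (m d : nat) : (m != 1)%N -> (m != 0)%N -> f m <= f (m + d)%N.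
Proof.
move=> m1 m0; elim: d => [|d IHd]; first by rewrite addn0.
have := f_step (m + d)%N; by rewrite -addnS; lia.
Qed.

Let f1_le_f3 : f 1%N <= f 3%N.
Proof. by have := f_step 1; have := f_step 2; rewrite /=; lia. Qed.

Let f0_le_f1 : f 0%N <= f 1%N.
Proof. by have := f_step 0; rewrite /=; lia. Qed.

Lemma distinct_odd_coef_ge1 n : n != 2%N -> 1 <= fps_coef F n.
Proof.
rewrite -/(f n); case: n => [|[|[|n]]] // _; first lia.
by have := @f_mono 3%N n isT isT; rewrite add3n; lia.
Qed.

Lemma distinct_odd_coef_ge0 n : 0 <= fps_coef F n.
Proof.
have [->|/distinct_odd_coef_ge1] := eqVneq n 2%N; last lia.
by rewrite -/(f 2%N); have := f_step 1; rewrite /=; lia.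
Qed.

(** From degree 0 an odd shift cannot land on degree 2; from degree 1 only [d = 1] does. *)
Lemma distinct_odd_coef_odd_shift m d : odd d ->
  fps_coef F m <= fps_coef F (m + d)%N + ((d == 1%N) && (m == 1%N))%:R.
Proof.
rewrite -/(f m) -/(f (m + d)%N); case: m => [|[|m]] odd_d.
- rewrite andbF addr0 add0n; case: d odd_d => [|[|[|d]]] //= _.
  by have := @f_mono 3%N d isT isT; rewrite add3n; lia.
- case: d odd_d => [|[|[|d]]] //= _; first by have := f_step 1; rewrite add1n /=; lia.
  by have := @f_mono 3%N d.+1 isT isT; rewrite add3n add1n; lia.
- by rewrite andbF addr0 f_mono.
Qed.

Lemma distinct_odd_coefMXn_odd_shift n a d : odd d ->
  fps_coef (F * fps_q ^+ (a + d)) n <=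
    fps_coef (F * fps_q ^+ a) n + ((d == 1%N) && (n == a + 2)%N)%:R.
Proof.
move=> odd_d; rewrite !fps_coefMXn; case: (leqP (a + d) n) => [le_adn|lt_nad].
  have := distinct_odd_coef_odd_shift (n - (a + d)) odd_d.
  have -> : (n - (a + d) + d = n - a)%N by lia.
  rewrite ifT; last lia.
  suff -> : (d == 1%N) && (n - (a + d) == 1)%N = (d == 1%N) && (n == a + 2)%N by [].
  by apply: andb_id2l => /eqP->; lia.
by apply: addr_ge0; [case: ifP => // _; apply: distinct_odd_coef_ge0|].
Qed.

End DistinctOddParts.

(** * The injective matching of index pairs, for an arbitrary non-negative array *)

Lemma ler_sum_matched (R : numDomainType) (r M : nat) (c : nat -> nat -> R) :
    (forall K J, 0 <= c K J) ->
  c 0%N 0%N + \sum_(k < M) \sum_(j < M)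
            (if (j < r * k.+1)%N then c k.+1 j else c k j.+1)
    <= \sum_(K < M.+1) \sum_(J < M.+1) c K J.
Proof.
move=> c_ge0.
(* With (k, l) = ([k.+1], [j.+1]), the first branch lands in the support of [G] and the second in
   that of [L]. These are disjoint as [r * K <= r * K.+1], so no entry is used twice. The unmatched
   band [E] contains (0, 0). *)
pose G (K J : nat) := if (J < r * K)%N then c K J else 0.
pose L (K J : nat) := if (r * K.+1 < J)%N then c K J else 0.
pose E (K J : nat) := if (r * K <= J <= r * K.+1)%N then c K J else 0.
have G_ge0 K J : 0 <= G K J by rewrite /G; case: ifP.
have L_ge0 K J : 0 <= L K J by rewrite /L; case: ifP.
have E_ge0 K J : 0 <= E K J by rewrite /E; case: ifP.
have -> : \sum_(K < M.+1) \sum_(J < M.+1) c K J =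
    \sum_(K < M.+1) \sum_(J < M.+1) E K J +
    (\sum_(K < M.+1) \sum_(J < M.+1) G K J + \sum_(K < M.+1) \sum_(J < M.+1) L K J).
  rewrite -!big_split; apply: eq_bigr => K _; rewrite -!big_split.
  apply: eq_bigr => J _ /=; rewrite /E /G /L.
  have leK : (r * K <= r * K.+1)%N by rewrite leq_mul2l leqnSn orbT.
  case: (leqP (r * K) J) => h1; case: (leqP J (r * K.+1)) => h2 /=.
  - by rewrite !addr0.
  - by rewrite !add0r.
  - by rewrite add0r addr0.
  - by move: (leq_trans (leq_ltn_trans leK h2) (ltnW h1)); rewrite ltnn.
apply: lerD.
  have -> : c 0%N 0%N = E 0%N 0%N by rewrite /E muln0.
  rewrite big_ord_recl big_ord_recl /= -addrA lerDl.
  by apply: addr_ge0; apply: sumr_ge0 => ? _ //; apply: sumr_ge0.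
have -> : \sum_(k < M) \sum_(j < M)
      (if (j < r * k.+1)%N then c k.+1 j else c k j.+1) =
    \sum_(k < M) \sum_(j < M) G k.+1 j + \sum_(k < M) \sum_(j < M) L k j.+1.
  rewrite -big_split; apply: eq_bigr => k _; rewrite -big_split.
  apply: eq_bigr => j _ /=; rewrite /G /L ltnS.
  by case: ltnP; rewrite ?addr0 ?add0r.
apply: lerD.
  rewrite [leRHS]big_ord_recl ler_wpDl //; first by apply: sumr_ge0.
  by apply: ler_sum => k _; rewrite [leRHS]big_ord_recr /= lerDl.
rewrite [leRHS]big_ord_recr /= ler_wpDr //; first by apply: sumr_ge0.
by apply: ler_sum => k _; rewrite [leRHS]big_ord_recl /= lerDr.
Qed.

Lemma sum_indicator_le1 (R : numDomainType) (I : finType) (b : pred I) :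
  (forall i j, b i -> b j -> i = j) -> \sum_i (b i)%:R <= 1 :> R.
Proof.
move=> b_inj; case: (pickP b) => [i bi|b0]; last first.
  by rewrite big1 ?ler01 // => i _; rewrite b0.
rewrite (bigD1 i) //= bi big1 ?addr0 // => j neq_ji.
by case: (boolP (b j)) => // bj; rewrite (b_inj _ _ bj bi) eqxx in neq_ji.
Qed.

(** * Comparison of the two truncated double sums in degree [n] *)

Theorem theorem6p2 (r : nat) (hr : (0 < r)%N) (n : nat) :
  0 <= fps_coef
    (qpochhammer (- fps_q) (fps_q ^+ 2) *
      (fps_series 0 (fun k =>
         fps_q ^+ (2 * k * r + 1) / (1 - fps_q ^+ (2 * (2 * k * r + 1)))) -
       fps_series 1 (fun k =>
         fps_q ^+ (4 * k * r) / (1 - fps_q ^+ (4 * k * r)))))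
    n.
Proof.
set F := qpochhammer _ _; set S1 := fps_series 0 _; set S2 := fps_series 1 _.
(* The ranges are those of [ler_sum_matched] with [M = n.+1]: size [M.+1] here, and size [M] in
   [v2], where the outer index starts at 1. *)
have v1 := @lambert_trunc (fun k => 2 * k * r + 1)%N
  (fun k => 2 * (2 * k * r + 1))%N 0 n.+1 n.+2 n.+2.
have v2 := @lambert_trunc (fun k => 4 * k * r)%N
  (fun k => 4 * k * r)%N 1 n.+1 n.+2 n.+1.
move: v1 v2; rewrite -/S1 -/S2; set s1 := \sum_(0 <= k < _) _.
set s2 := \sum_(1 <= k < _) _ => v1 v2.
have -> : F * (S1 - S2) = F * s1 - F * s2 + (F * (S1 - s1) - F * (S2 - s2)) by ring.
rewrite fps_coefD [X in _ + X]fps_coefB.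
rewrite (fps_vanishMl _ (v1 _ _ _)) //; last by move=> k ? /=; apply/andP; split; nia.
rewrite (fps_vanishMl _ (v2 _ _ _)) //; last by move=> k ? /=; apply/andP; split; nia.
rewrite subrr addr0 fps_coefB subr_ge0 {S1 S2 v1 v2}.
pose T a := fps_coef (F * fps_q ^+ a) n.
have T_ge0 a : 0 <= T a.
  by rewrite /T fps_coefMXn; case: ifP => // _; apply: distinct_odd_coef_ge0.
have -> : fps_coef (F * s1) n =
    \sum_(K < n.+2) \sum_(J < n.+2) T ((2 * K * r + 1) + 2 * (2 * K * r + 1) * J)%N.
  rewrite /s1 big_mkord mulr_sumr fps_coef_sum; apply: eq_bigr => K _.
  by rewrite mulr_sumr fps_coef_sum.
have -> : fps_coef (F * s2) n =
    \sum_(k < n.+1) \sum_(j < n.+1) T (4 * k.+1 * r + 4 * k.+1 * r * j)%N.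
  rewrite /s2 big_add1 big_mkord mulr_sumr fps_coef_sum; apply: eq_bigr => k _.
  by rewrite mulr_sumr fps_coef_sum.
pose c K J := T ((2 * K * r + 1) + 2 * (2 * K * r + 1) * J)%N.
(* The exceptional pairs: l = rk and n = (2rk)^2 + 1, where f(1) is compared with f(2) and 1 may be
   lost. *)
pose b (k j : nat) := (j.+1 == r * k.+1)%N && (n == (2 * (r * k.+1)) ^ 2 + 1)%N.
apply: le_trans (@ler_sum_matched _ r n.+1 c (fun _ _ => T_ge0 _)).
apply: (@le_trans _ _ (\sum_(k < n.+1) \sum_(j < n.+1) (b k j)%:R +
    \sum_(k < n.+1) \sum_(j < n.+1)
      (if (j < r * k.+1)%N then c k.+1 j else c k j.+1))).
  rewrite -big_split; apply: ler_sum => k _; rewrite -big_split.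
  apply: ler_sum => j _ /=; rewrite addrC /b /c.
  case: ltnP => [lt_j|ge_j].
    (* The gap 4rkl - (2rk+1)(2l-1) = 2(rk-l) + 1, equal to 1 only for l = rk. *)
    have /(distinct_odd_coefMXn_odd_shift n) : odd (2 * (r * k.+1 - j.+1) + 1) by lia.
    move=> /(_ (2 * k.+1 * r + 1 + 2 * (2 * k.+1 * r + 1) * j)%N).
    rewrite -!/(T _); set a := (X in T X <= _); set a' := (X in _ -> T X <= _).
    have -> : a = a' by rewrite /a /a'; nia.
    move=> /le_trans-> //; rewrite lerD2l ler_nat.
    case: eqP => //= d1; have -> : (j.+1 == r * k.+1)%N by lia.
    by case: eqP => //= nE; rewrite lt0b; apply/eqP; nia.
  (* The gap 4rkl - (2r(k-1)+1)(2l+1). Since l > rk and r >= 1 it is at least 3, so no correction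
     arises in this branch. *)
  have d_odd : odd (2 * (2 * r * j.+1 - r * k - j.+1 - 1) + 1) by lia.
  have := distinct_odd_coefMXn_odd_shift n (2 * k * r + 1 + 2 * (2 * k * r + 1) * j.+1)%N d_odd.
  rewrite -!/(T _); set a := (X in T X <= _); set a' := (X in _ -> T X <= _).
  have -> : a = a' by rewrite /a /a'; nia.
  move=> /le_trans-> //; rewrite lerD2l ler_nat.
  by case: eqP => //= d1; nia.
apply: lerD => //; rewrite pair_bigA /=.
case: (pickP (fun p : 'I_n.+1 * 'I_n.+1 => b p.1 p.2)) => [p|b0]; last first.
  by rewrite big1 => [|p _]; [apply: T_ge0|rewrite b0].
move=> /andP[_ /eqP nE]; apply: le_trans (_ : 1 <= _).
  (* [n] determines rk, hence k because r > 0, hence l = rk. *)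
  apply: sum_indicator_le1 => -[k j] [k' j'] /= /andP[/eqP jE /eqP kE].
  move=> /andP[/eqP jE' /eqP kE'].
  have eqX : (r * k.+1 = r * k'.+1)%N by nia.
  have eqk : k = k' by apply: val_inj => /=; nia.
  by congr (_, _) => //; apply: val_inj => /=; lia.
(* [c 0 0] is f(n-1), and n-1 = (2rk)^2 is at least 4, hence not the degree 2 excluded in
   [distinct_odd_coef_ge1]. *)
rewrite /c /T fps_coefMXn muln0 !mul0n /= ifT; last lia.
by apply: distinct_odd_coef_ge1; nia.
Qed.
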